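(* Every double coset separable group satisfies the Wilson-Zalesskii property.
   Context: The profinite topology on a group $G$ is the topology in which the finite index normal subgroups of $G$ form a basis of open neighborhoods of the identity. A subset of $G$ is separable in $G$ if it is closed in this topology. $\widehat{G}$ denotes the profinite completion of $G$ (the inverse limit of the finite quotients $G/N$ over all finite index normal subgroups $N$ of $G$), and for $S \subseteq G$, $\overline{S}$ denotes the closure in $\widehat{G}$ of (the image of) $S$. For subsets $A,B \subseteq G$, $AB=\{ab \mid a \in A,\ b \in B\}$. A group $G$ is double coset separable if $HK$ is separable in $G$ for all finitely generated subgroups $H,K$ of $G$. (Taking $H=K=\{1\}$, such a group is residually finite, so it embeds in $\widehat G$.) A group $G$ has the Wilson-Zalesskii property if $\overline{H}\cap\overline{K}=\overline{H \cap K}$ in $\widehat{G}$ for all finitely generated subgroups $H,K$ of $G$. *)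

(* Defs.v *)
From HB Require Import structures.
From mathcomp Require Import all_boot.
From mathcomp Require Import all_classical.
From mathcomp Require Import topology_structure initial_topology.
From mathcomp Require Import discrete_topology subtype_topology function_spaces.

Set Implicit Arguments.
Unset Strict Implicit.
Unset Printing Implicit Defensive.

Local Open Scope classical_set_scope.
Local Open Scope group_scope.

(* In [left_cosets] and [finite_quotient], [G / N] is literally the set of left
   cosets [g N], each coset being a subset of [G]. *)

(* [groupType] also carries a choice structure, which by [boolp] every type
   has, so it covers arbitrary, possibly infinite, groups. *)

Section Subsets.
Context {G : groupType}.
Implicit Types (A B H N : set G) (g : G).

Definition set_mulg A B : set G := [set a * b | a in A & b in B].

Definition lcoset g N : set G := [set g * n | n in N].

Definition subgroup H : Prop := group_closed (mem H).

Definition finitely_generated_subgroup H : Prop :=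
  exists2 S : set G, finite_set S & H = smallest subgroup S.

Definition left_cosets N : set (set G) := range (lcoset^~ N).

Definition finite_index_normal N : Prop :=
  [/\ subgroup N, (forall g n, N n -> N (n ^ g)) & finite_set (left_cosets N)].

End Subsets.

Section SubsetFacts.
Context {G : groupType}.
Implicit Types (A B H N M : set G) (g : G).

Lemma subgroupP H : subgroup H <->
  [/\ H 1, (forall x y, H x -> H y -> H (x * y)) & (forall x, H x -> H x^-1)].
Proof.
split=> [Hc|[H1 HM HV]].
  have HV : forall x, H x -> H x^-1.
    by move=> x Hx; apply/set_mem/(group_closedV Hc)/mem_set.
  split=> //; first by case: Hc => /set_mem.
  by move=> x y Hx Hy; apply/set_mem/(group_closedM Hc); exact/mem_set.
split; first exact/mem_set.
by move=> x y /set_mem Hx /set_mem Hy; apply/mem_set/HM => //; exact: HV.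
Qed.

Lemma mem_lcoset H g x : lcoset g H x <-> H (g^-1 * x).
Proof.
split=> [[n Hn <-]|Hx]; first by rewrite mulKg.
by exists (g^-1 * x) => //; rewrite mulVKg.
Qed.

Lemma finite_index_normalT : finite_index_normal [set: G].
Proof.
split=> //; first exact/subgroupP.
apply: (@sub_finite_set _ _ [set [set: G]]); last exact: finite_set1.
by move=> _ [g _ <-]; apply/seteqP; split=> // x _; apply/mem_lcoset.
Qed.

Lemma finite_index_normalI N M : finite_index_normal N ->
  finite_index_normal M -> finite_index_normal (N `&` M).
Proof.
move=> [/subgroupP[N1 NM NV] Nn Nf] [/subgroupP[M1 MM MV] Mn Mf]; split.
- apply/subgroupP; split=> //.
    by move=> x y [Nx Mx] [Ny My]; split; [exact: NM|exact: MM].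
  by move=> x [Nx Mx]; split; [exact: NV|exact: MV].
- by move=> g n [Nx Mx]; split; [exact: Nn|exact: Mn].
apply: (sub_finite_set _ (finite_image2 setI Nf Mf)) => _ [g _ <-].
exists (lcoset g N); first by exists g.
exists (lcoset g M); first by exists g.
by apply/seteqP; split=> x; rewrite /setI /= !mem_lcoset.
Qed.

End SubsetFacts.

Definition profinite_topology (G : groupType) : Type := G.

Section ProfiniteTopology.
Context {G : groupType}.
Local Notation T := (profinite_topology G).

Definition profinite_nbhs (g : T) : set_system T :=
  [set A | exists2 N : set G, finite_index_normal N & lcoset (g : G) N `<=` A].

Lemma profinite_nbhs_filter (g : T) : ProperFilter (profinite_nbhs g).
Proof.
split.
  move=> [N [/subgroupP[N1 _ _] _ _]] /(_ (g : G)); apply.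
  by apply/mem_lcoset; rewrite mulVg.
split.
- by exists setT => //; exact: finite_index_normalT.
- move=> A B [N hN NA] [M hM MB].
  exists (N `&` M); first exact: finite_index_normalI.
  by move=> _ [x [Nx Mx] <-]; split; [apply: NA|apply: MB]; exists x.
- by move=> A B AB [N hN NA]; exists N => //; exact: subset_trans AB.
Qed.

Lemma profinite_nbhs_singleton (g : T) (A : set T) :
  profinite_nbhs g A -> A g.
Proof.
move=> [N [/subgroupP[N1 _ _] _ _]]; apply.
by apply/mem_lcoset; rewrite mulVg.
Qed.

Lemma profinite_nbhs_nbhs (g : T) (A : set T) :
  profinite_nbhs g A -> profinite_nbhs g (profinite_nbhs^~ A).
Proof.
move=> [N hN NA]; exists N => // _ [n Nn <-]; exists N => // _ [m Nm <-].
apply: NA; exists (n * m); last exact: mulgA.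
by case: hN => /subgroupP[_ NM _] _ _; exact: NM.
Qed.

HB.instance Definition _ := Choice.copy T G.
HB.instance Definition _ := hasNbhs.Build T profinite_nbhs.
HB.instance Definition _ := Nbhs_isNbhsTopological.Build T
  profinite_nbhs_filter profinite_nbhs_singleton profinite_nbhs_nbhs.

End ProfiniteTopology.

Definition separable {G : groupType} (A : set G) : Prop :=
  closed (A : set (profinite_topology G)).

Section ProfiniteCompletion.
Variable G : groupType.

Definition finite_index_normal_subgroup : Type :=
  {N : set G | finite_index_normal N}.

Definition finite_quotient (N : finite_index_normal_subgroup) :
    topologicalType :=
  discrete_topology (set_type (left_cosets (sval N))).

(* The inverse limit of the [G / N], as a subset of their product: for
   [N `<=` M] the transition map [G / N -> G / M] sends a coset [C] to [C M]. *)
Definition compatible_families : set (prod_topology finite_quotient) :=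
  [set x | forall N M : finite_index_normal_subgroup, sval N `<=` sval M ->
     set_mulg (val (x N)) (sval M) = val (x M)].

(* Only the underlying space of the completion is needed: closures in it do not
   involve its group law. *)
Definition profinite_completion : topologicalType :=
  set_type compatible_families.

Definition coset_family (g : G) : prod_topology finite_quotient :=
  fun N => exist _ (lcoset g (sval N)) (mem_set (imageT (lcoset^~ (sval N)) g)).

Lemma coset_family_compatible (g : G) : coset_family g \in compatible_families.
Proof.
apply/mem_set => -[N hN] [M hM] /= NM.
have [/subgroupP[N1 _ _] _ _] := hN; have [/subgroupP[_ MM _] _ _] := hM.
apply/seteqP; split=> [_ [_ [n Nn <-] [m Mm <-]]|_ [m Mm <-]].
  by exists (n * m); [apply: MM => //; exact: NM|exact: mulgA].
by exists g; [exists 1 => //; exact: mulg1|exists m].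
Qed.

Definition to_completion (g : G) : profinite_completion :=
  exist _ (coset_family g) (coset_family_compatible g).

Definition completion_closure (S : set G) : set profinite_completion :=
  closure (to_completion @` S).

End ProfiniteCompletion.

Definition double_coset_separable (G : groupType) : Prop :=
  forall H K : set G, finitely_generated_subgroup H ->
    finitely_generated_subgroup K -> separable (set_mulg H K).

Definition Wilson_Zalesskii (G : groupType) : Prop :=
  forall H K : set G, finitely_generated_subgroup H ->
    finitely_generated_subgroup K ->
    completion_closure H `&` completion_closure K =
    completion_closure (H `&` K).

(* Main.v *)
Require Import Defs.
From mathcomp Require Import all_boot.
From mathcomp Require Import all_classical.
From mathcomp Require Import topology_structure initial_topology.
From mathcomp Require Import supremum_topology discrete_topology.
From mathcomp Require Import subtype_topology function_spaces.

(** Let [x] lie in the closures of both [H] and [K], and let [N] be a normal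
    subgroup of finite index. Some [h] in [H] represents the [N]-coordinate of
    [x], and the point is to move [h] inside [h N] until it lands in [K],
    without leaving [H]; that is, to write [h] as an element of [K L], where
    [L] is [H `&` N]. For any smaller normal subgroup [M] of finite index, [x]
    has representatives [h'] in [H] and [k'] in [K] modulo [M]. Then [h'^-1 h]
    is in [L], and [k' (h'^-1 h)] is congruent to [h] modulo [M]; hence [h]
    belongs to the profinite closure of [K L]. By Schreier's lemma [L] is
    finitely generated, so that [K L] is separable and [h = k l] with [k] in [K]
    and [l] in [L]. Now [k = h l^-1] is in [H `&` K], and it represents the
    [N]-coordinate of [x].

    This argument works one coordinate at a time, which
    [completion_closureP] justifies: the coordinates of a point of an inverse
    limit over a directed system determine its neighbourhoods singly, not just
    through finite sets of coordinates. *)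

Set Implicit Arguments.
Unset Strict Implicit.
Unset Printing Implicit Defensive.

Local Open Scope classical_set_scope.
Local Open Scope group_scope.

Section Cosets.
Context {G : groupType}.
Implicit Types (H K N S : set G) (g h x y : G).

Lemma mem_lcoset_self N g : subgroup N -> lcoset g N g.
Proof. by move=> /subgroupP[N1 _ _]; apply/mem_lcoset; rewrite mulVg. Qed.

Lemma lcoset_eqP N g h : subgroup N ->
  lcoset g N = lcoset h N <-> N (g^-1 * h).
Proof.
move=> sN; have /subgroupP[N1 NM NV] := sN; split=> [gh|Ngh].
  by apply/mem_lcoset; rewrite gh; exact: mem_lcoset_self.
apply/seteqP; split=> x /mem_lcoset Nx; apply/mem_lcoset.
  have -> : h^-1 * x = (g^-1 * h)^-1 * (g^-1 * x).
    by rewrite invgM invgK -mulgA mulVKg.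
  by apply: NM => //; exact: NV.
have -> : g^-1 * x = (g^-1 * h) * (h^-1 * x) by rewrite -mulgA mulVKg.
exact: NM.
Qed.

Lemma subgroupI H K : subgroup H -> subgroup K -> subgroup (H `&` K).
Proof.
move=> /subgroupP[H1 HM HV] /subgroupP[K1 KM KV]; apply/subgroupP; split=> //.
  by move=> x y [Hx Kx] [Hy Ky]; split; [exact: HM|exact: KM].
by move=> x [Hx Kx]; split; [exact: HV|exact: KV].
Qed.

Lemma smallest_subgroup S : subgroup (smallest subgroup S).
Proof.
apply/subgroupP; split.
- by move=> A [/subgroupP[A1 _ _] _].
- move=> x y Hx Hy A SA; have [/subgroupP[_ AM _] _] := SA.
  by apply: AM; [exact: Hx|exact: Hy].
- move=> x Hx A SA; have [/subgroupP[_ _ AV] _] := SA.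
  by apply: AV; exact: Hx.
Qed.

Lemma finitely_generated_is_subgroup H :
  finitely_generated_subgroup H -> subgroup H.
Proof. by move=> [S _ ->]; exact: smallest_subgroup. Qed.

(** Schreier's lemma. Choose a representative [r y] in [H] of each coset [y N]
    that meets [H]. The Schreier elements [c x y = (r (x y))^-1 x (r y)] satisfy
    [c (x x') y = c x (x' y) * c x' y], so those with [x] a generator of [H]
    generate all of them, and they are finitely many because [c x y] depends on
    [y] only through [r y]. Finally [c x 1] is the conjugate of [x] by [r 1]
    for every [x] in [H `&` N], and [r 1] is itself in [H `&` N]. *)
Lemma finitely_generated_subgroupI H N : finitely_generated_subgroup H ->
  subgroup N -> finite_set (left_cosets N) ->
  finitely_generated_subgroup (H `&` N).
Proof.
move=> fgH sN Nfin; have sH := finitely_generated_is_subgroup fgH.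
have [S Sfin HE] := fgH.
have [H1 HM HV] := proj1 (subgroupP _) sH.
have [N1 NM NV] := proj1 (subgroupP _) sN.
have SH : S `<=` H by rewrite HE; exact: sub_gen_smallest.
pose rep (C : set G) : G := xget 1 (C `&` H).
pose r y := rep (lcoset y N).
have r_spec y : H y -> lcoset y N (r y) /\ H (r y).
  move=> Hy; suff : (lcoset y N `&` H) (r y) by [].
  by apply: xgetPex; exists y; split=> //; exact: mem_lcoset_self.
have rH y : H y -> H (r y) by move=> /r_spec[].
have rN y : H y -> N (y^-1 * r y) by move=> /r_spec[/mem_lcoset].
have r_eq y z : N (y^-1 * z) -> r y = r z.
  by move=> Nyz; rewrite /r (_ : lcoset y N = lcoset z N) //; exact/lcoset_eqP.
pose c x y := (r (x * y))^-1 * x * r y.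
have r_rep x y : H y -> r (x * r y) = r (x * y).
  by move=> Hy; apply/esym/r_eq; rewrite invgM -mulgA mulKg; exact: rN.
pose gens := [set c s y | s in S & y in (rep @` left_cosets N) `&` H].
have c_gens s y : S s -> H y -> gens (c s y).
  move=> Ss Hy; exists s => //; exists (r y).
    by split; [exists (lcoset y N) => //; exists y|exact: rH].
  rewrite /c r_rep // (_ : r (r y) = r y) //.
  by rewrite -[X in r X]mul1g r_rep // mul1g.
exists gens.
  apply: finite_image2 => //; apply: finite_setIl; exact: finite_image.
apply/seteqP; split; last first.
  apply: smallest_sub; first exact: subgroupI.
  move=> _ [s Ss [y [_ Hy] <-]]; have Hs := SH _ Ss; have Hsy := HM _ _ Hs Hy.
  split; first by apply: (HM _ _ _ (rH _ Hy)); apply: HM => //; exact/HV/rH.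
  have -> : c s y = ((s * y)^-1 * r (s * y))^-1 * (y^-1 * r y).
    by rewrite /c !invgM !invgK -!mulgA mulVKg.
  by apply: NM; [exact/NV/rN|exact: rN].
set L := smallest subgroup gens.
have /subgroupP[L1 LM LV] : subgroup L := smallest_subgroup gens.
have c_L x y : H x -> H y -> L (c x y).
  suff HP : H `<=` [set z | H z /\ forall y, H y -> L (c z y)].
    by move=> /HP[_]; apply.
  rewrite {1}HE; apply: smallest_sub; last first.
    move=> s Ss; split; first exact: SH.
    by move=> z Hz; apply: sub_gen_smallest; exact: c_gens.
  apply/subgroupP; split.
  - by split=> // z Hz; rewrite /c mul1g mulg1 mulVg.
  - move=> x1 x2 [Hx1 Lx1] [Hx2 Lx2]; split; first exact: HM.
    move=> z Hz; have -> : c (x1 * x2) z = c x1 (x2 * z) * c x2 z.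
      by rewrite /c !mulgA mulgK.
    by apply: LM; [apply: Lx1; exact: HM|exact: Lx2].
  - move=> z [Hz Lz]; split; first exact: HV.
    move=> t Ht; have -> : c z^-1 t = (c z (z^-1 * t))^-1.
      by rewrite /c mulVKg !invgM !invgK mulgA.
    by apply: LV; apply: Lz; apply: HM => //; exact: HV.
pose a := r 1.
have Ha : H a by exact: rH.
have Na : N a by have := rN _ H1; rewrite invg1 mul1g.
have conj_L z : H z -> N z -> L (a^-1 * z * a).
  move=> Hz Nz; have := c_L _ _ Hz H1; rewrite /c mulg1 (_ : r z = a) //.
  by apply: r_eq; rewrite mulg1; exact: NV.
move=> x [Hx Nx]; rewrite (_ : x = a^-1 * (a * x * a^-1) * a).
  by apply: conj_L; [apply: (HM _ _ (HM _ _ Ha Hx)); exact: HV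
                    |apply: (NM _ _ (NM _ _ Na Nx)); exact: NV].
by rewrite !mulgA mulVg mul1g mulgVK.
Qed.

End Cosets.

Section Completion.
Variable G : groupType.
Implicit Types (N M : finite_index_normal_subgroup G).
Implicit Types (x : profinite_completion G) (g : G) (S : set G).

Definition coordinate x N : set G := val (val x N).

Lemma set_mulg_coordinate x N M : sval N `<=` sval M ->
  set_mulg (coordinate x N) (sval M) = coordinate x M.
Proof. exact: (set_mem (valP x)). Qed.

Lemma coordinate_eqS x y N M : sval N `<=` sval M ->
  coordinate y N = coordinate x N -> coordinate y M = coordinate x M.
Proof. by move=> NM yN; rewrite -!(set_mulg_coordinate _ NM) yN. Qed.

Lemma coordinate_lcosetS x g N M : sval N `<=` sval M ->
  coordinate x N = lcoset g (sval N) -> coordinate x M = lcoset g (sval M).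
(* [lcoset g (sval M)] is the coordinate at [M] of the image of [g]. *)
Proof. exact: (@coordinate_eqS (to_completion g) x). Qed.

Lemma nbhs_coordinate x N :
  nbhs x [set y | coordinate y N = coordinate x N].
Proof.
have cval : continuous (val : profinite_completion G -> _).
  exact: initial_continuous.
have xN : nbhs (val x) [set f : prod_topology _ | f N = val x N].
  have /cvg_sup/(_ N) : nbhs (val x) --> val x by exact: cvg_id.
  apply; exists [set f : prod_topology (@finite_quotient G) | f N = val x N].
  split=> //; exists [set val x N] => //; exact: discrete_open.
apply: (@filterS _ _ (nbhs_filter x) _ _ _ (cval x _ xN)) => y /= yN.
by rewrite /coordinate [val y N]yN.
Qed.

(** A neighbourhood of [x] constrains only finitely many coordinates, and all of
    these are determined by the coordinate at the intersection of their
    indices. So the sets fixing a single coordinate form a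
    filter base, and not merely a subbasis. *)
Lemma nbhs_completion x (A : set (profinite_completion G)) : nbhs x A ->
  exists N, [set y | coordinate y N = coordinate x N] `<=` A.
Proof.
move=> [_ [[W oW <-] Wx] WA].
pose F : set_system (prod_topology (@finite_quotient G)) :=
  [set B | exists N, forall y, coordinate y N = coordinate x N -> B (val y)].
have FF : Filter F.
  split.
  - by exists (exist _ _ finite_index_normalT).
  - move=> B C [N NB] [M MC].
    pose NM : finite_index_normal_subgroup G :=
      exist _ _ (finite_index_normalI (svalP N) (svalP M)).
    exists NM => y yNM.
    split; [apply: NB|apply: MC].
      by apply: (coordinate_eqS (N := NM)) => // ? [].
    by apply: (coordinate_eqS (N := NM)) => // ? [].
  - by move=> B C BC [N NB]; exists N => y /NB/BC.
have Fx : F --> val x.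
  apply/cvg_sup => N C [_ [[B _ <-] Bx] BC]; exists N => y yN; apply: BC.
  by rewrite /= (val_inj yN).
have [N NW] := Fx _ (open_nbhs_nbhs (conj oW Wx)).
by exists N => y /NW/WA.
Qed.

Lemma completion_closureP S x : completion_closure S x <->
  forall N, exists2 s, S s & coordinate x N = lcoset s (sval N).
Proof.
split=> [clx N|xS A /nbhs_completion[N NA]].
  by have [_ [[s Ss <-] sN]] := clx _ (nbhs_coordinate x N); exists s.
have [s Ss xN] := xS N; exists (to_completion s).
by split; [exists s|apply: NA].
Qed.

End Completion.

Theorem corollary1p2 (G : groupType) :
  double_coset_separable G -> Wilson_Zalesskii G.
Proof.
move=> dcs H K fgH fgK; apply/seteqP; split; last first.
  move=> x xHK; split; apply/completion_closureP => N.
    by have /completion_closureP/(_ N)[s [Hs _] ?] := xHK; exists s.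
  by have /completion_closureP/(_ N)[s [_ Ks] ?] := xHK; exists s.
move=> x [/completion_closureP xH /completion_closureP xK].
apply/completion_closureP => N; have [h Hh xN] := xH N.
have /subgroupP[H1 HM HV] := finitely_generated_is_subgroup fgH.
have [sN _ Nfin] := svalP N; have /subgroupP[N1 NM NV] := sN.
have fgL := finitely_generated_subgroupI fgH sN Nfin.
have : set_mulg K (H `&` sval N) h.
  apply: (dcs _ _ fgK fgL) => B [M hM hMB].
  have hNM := finite_index_normalI (svalP N) hM.
  pose NM' : finite_index_normal_subgroup G := exist _ _ hNM.
  have [h' Hh' xh'] := xH NM'; have [k' Kk' xk'] := xK NM'.
  have [sNM _ _] := hNM.
  exists (k' * (h'^-1 * h)); split.
    exists k' => //; exists (h'^-1 * h) => //; split.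
      by apply: HM => //; exact: HV.
    apply/lcoset_eqP => //; rewrite -xN; apply/esym.
    by apply: coordinate_lcosetS xh' => ? [].
  apply: hMB; apply/mem_lcoset.
  have [_ k'h'] : (sval N `&` M) (h'^-1 * k').
    by apply/lcoset_eqP => //; rewrite -xh' -xk'.
  have [_ Mnormal _] := hM.
  (* [k' (h'^-1 h)] is [h] modulo [M] since [h'^-1 k'] is in the normal [M]. *)
  have -> : h^-1 * (k' * (h'^-1 * h)) = (h'^-1 * k') ^ (h'^-1 * h).
    by rewrite conjgE invgM invgK !mulgA mulgK.
  exact: Mnormal.
move=> [k Kk [l [Hl Nl] kl]].
have kE : k = h * l^-1 by rewrite -kl mulgK.
exists k; first by split=> //; rewrite kE; apply: HM => //; exact: HV.
by rewrite xN; apply/lcoset_eqP => //; rewrite kE mulKg; exact: NV.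
Qed.
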